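(* The set $\mathcal{BG}_\omega$ of all Bruckner-Garg functions $f:[0,1]\to\mathbb{R}$ is strongly $\mathfrak{c}$-algebrable (as a subset of the algebra $\mathbb{R}^{[0,1]}$).
   Context: A subset of $[0,1]$ is called a Cantor set if it is homeomorphic to the ternary Cantor set. A continuous function $f:[0,1]\to\mathbb{R}$ is Bruckner-Garg of rank $k\in\mathbb{N}$ if there is a countable set $A\subseteq(\min f,\max f)$ such that for all $x\in A$ the preimage $f^{-1}(\{x\})$ is the union of a Cantor set with at most $k$ isolated points, and for all $x\in(\min f,\max f)\setminus A$ the preimage $f^{-1}(\{x\})$ is a Cantor set. A function is Bruckner-Garg (belongs to $\mathcal{BG}_\omega$) if it is Bruckner-Garg of rank $k$ for some $k\in\mathbb{N}$. $\mathfrak{c}=2^{\omega}$ is the cardinality of the continuum. $\mathbb{R}^{[0,1]}$ is the real commutative algebra of all functions $[0,1]\to\mathbb{R}$ with pointwise operations. A subset $S$ of a commutative real algebra $\mathcal{L}$ is strongly $\kappa$-algebrable if $S\cup\{0\}$ contains a $\kappa$-generated algebra isomorphic to a free (commutative, non-unital) algebra; equivalently, there is a set $X\subseteq\mathcal{L}$ of cardinality $\kappa$ such that for every $k\ge 1$, every nonzero real polynomial $P$ in $k$ variables without constant term and all distinct $y_1,\dots,y_k\in X$, we have $P(y_1,\dots,y_k)\neq 0$ and $P(y_1,\dots,y_k)\in S$. *)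

(* Defs.v *)
From mathcomp Require Import all_boot all_order all_algebra.
From mathcomp Require Import all_classical all_reals all_analysis.
(* Only canonical structures are imported: the notations of mpoly clash with
   those of MathComp-Analysis. *)
From mathcomp Require mpoly.
Import (canonicals) mpoly.

Set Implicit Arguments.
Unset Strict Implicit.
Unset Printing Implicit Defensive.

Import Order.TTheory GRing.Theory Num.Theory.
Import numFieldNormedType.Exports.
Local Open Scope classical_set_scope.
Local Open Scope card_scope.
Local Open Scope ring_scope.

(* A subset of a topological space is used as a type below through the coercion
   [set_type]; as such it carries the subspace topology. *)

Definition homeomorphic (S T : topologicalType) : Prop :=
  exists (f : S -> T) (g : T -> S),
    [/\ continuous f, continuous g, cancel f g & cancel g f].

Fixpoint ternary_step {R : realType} (n : nat) : set R :=
  if n is m.+1 then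
    [set x / 3 | x in ternary_step m] `|`
    [set (x + 2) / 3 | x in ternary_step m]
  else `[0, 1].

Definition ternary_cantor_set (R : realType) : set R :=
  \bigcap_(n in [set: nat]) ternary_step n.
Arguments ternary_cantor_set : clear implicits.

Definition unit_interval (R : realType) : set R := `[0, 1].
Arguments unit_interval : clear implicits.

Definition is_cantor_set (R : realType) (C : set (unit_interval R)) : Prop :=
  homeomorphic C (ternary_cantor_set R).

(* [f a] and [f b] are min f and max f.  The points of [F] are isolated points
   of the whole preimage, which has at most [k] of them outside [C]. *)
Definition bruckner_garg_rank (R : realType) (k : nat)
    (f : unit_interval R -> R) : Prop :=
  continuous f /\
  exists a b : unit_interval R,
    (forall x, f a <= f x <= f b) /\
    exists A : set R,
      [/\ countable A,
          A `<=` `]f a, f b[,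
          forall y, A y ->
            exists C F : set (unit_interval R),
              [/\ is_cantor_set C,
                  F `<=` isolated (f @^-1` [set y]),
                  F #<= `I_k &
                  f @^-1` [set y] = C `|` F] &
          forall y, (`]f a, f b[ `\` A) y -> is_cantor_set (f @^-1` [set y])].

Definition bruckner_garg (R : realType) : set (unit_interval R -> R) :=
  [set f | exists k, bruckner_garg_rank k f].

(* Evaluation of [P] in the algebra of all functions [T -> R] with pointwise
   operations. *)
Definition fun_meval (R : realType) (T : Type) (k : nat)
    (y : 'I_k -> T -> R) (P : mpoly.mpoly k R) : T -> R :=
  fun x => mpoly.meval (fun i => y i x) P.

(* The cardinal kappa is represented by any set [K] of that cardinality. *)
Definition strongly_algebrable (R : realType) (T U : Type) (K : set U)
    (S : set (T -> R)) : Prop :=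
  exists X : set (T -> R),
    X #= K /\
    forall (k : nat) (P : mpoly.mpoly k R) (y : 'I_k -> T -> R),
      (1 <= k)%N ->
      P <> 0 ->
      mpoly.mcoeff mpoly.mnm0 P = 0 ->
      injective y ->
      (forall i, X (y i)) ->
      fun_meval y P <> (fun _ => 0) /\ S (fun_meval y P).

(* Main.v *)
Require Import Defs.
From HB Require Import structures.
From mathcomp Require Import all_boot all_order all_algebra.
From mathcomp Require Import all_classical all_reals all_analysis.
From mathcomp Require Import ring lra zify.
From mathcomp Require mpoly.
Import (canonicals) mpoly.

(** Two ingredients are combined.

    The first is a Gillis function [F]: a continuous function all of whose
    level sets over the unit interval, the extreme ones included, are Cantor
    sets.  It is the fixed point of a contraction that replaces a graph rising
    from 0 to 1 by six half-size copies of it, running up, down, up through the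
    values below 1/2 and then up, down, up through the values above 1/2.  On
    every interval of the subdivision of any depth, [F] is an affine copy of
    itself, and it takes each of its values on two separate pieces.  So no point
    is isolated in its level set ([gillis_level_near]), while [F] is constant on
    no interval.  By Brouwer's theorem ([homeomorphism_cantor_like]) a nonempty
    compact subset of the line without isolated points and without intervals is
    a Cantor set, so nothing more has to be known about the level sets.

    Both properties survive composition with any continuous [h] that is constant
    on no interval: a point that repeats a value of [F] nearby also repeats the
    value of [h \o F], and an interval inside a level set of [h \o F] would be
    mapped by [F] onto an interval on which [h] is constant.  Hence [h \o F] is
    Bruckner-Garg of rank 0, with an empty exceptional set
    ([bruckner_garg_rank0_comp]).

    The second ingredient supplies many such [h] whose polynomials are again
    such [h]: the functions [t |-> expR (beta * t)].  A polynomial without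
    constant term in several of them is an exponential sum whose exponents are
    the combinations of the betas with the multi-indices as coefficients.  When
    the betas are linearly independent over the integers, these exponents are
    distinct and nonzero, and such a sum is constant on no interval because
    exponentials with distinct exponents are linearly independent on every
    interval ([expsum_nonconst]).

    A family of independent betas indexed by all 0-1 sequences is given by the
    series of inverse factorials over the codes of the finite prefixes of a
    sequence.  Distinct sequences have almost disjoint sets of prefixes, so in a
    vanishing integer combination some digits at arbitrarily large places are
    single coefficients of the combination, whereas a factorial series with
    bounded integer digits and sum 0 has only finitely many nonzero digits
    ([factorial_expansion_eq0], [exponent_free]). *)

Set Implicit Arguments.
Unset Strict Implicit.
Unset Printing Implicit Defensive.

Import Order.TTheory GRing.Theory Num.Theory.
Import numFieldNormedType.Exports.
Local Open Scope classical_set_scope.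
Local Open Scope ring_scope.

(** * Cantor subsets of the line *)

Lemma homeomorphic_trans (S T U : topologicalType) :
  homeomorphic S T -> homeomorphic T U -> homeomorphic S U.
Proof.
move=> [f [g [cf cg fK gK]]] [f' [g' [cf' cg' fK' gK']]].
exists (f' \o f), (g \o g'); split.
- by move=> x; apply: continuous_comp; [exact: cf|exact: cf'].
- by move=> x; apply: continuous_comp; [exact: cg'|exact: cg].
- by move=> x /=; rewrite fK' fK.
- by move=> x /=; rewrite gK gK'.
Qed.

Lemma homeomorphic_sym (S T : topologicalType) :
  homeomorphic S T -> homeomorphic T S.
Proof. by move=> [f [g [cf cg fK gK]]]; exists g, f. Qed.

Lemma cantor_like_homeomorphic_cantor_space (R : realType)
    (T : pseudoMetricType R) (t0 : T) :
  cantor_like T -> homeomorphic cantor_space T.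
Proof.
move=> cT.
(* Brouwer's theorem [homeomorphism_cantor_like] concerns pointed spaces. *)
pose pT : pseudoPMetricType R :=
  HB.pack (Equality.sort T : Type) T (isPointed.Build (T : Type) t0).
have [f [cf clf]] := @homeomorphism_cantor_like R pT cT.
pose g : T -> cantor_space := (f^-1)%FUN.
have fK : cancel f g by move=> x; apply: funK; rewrite inE.
have gK : cancel g f by move=> x; apply: invK; rewrite inE.
exists f, g; split => //.
apply/continuous_closedP => A cA.
suff -> : g @^-1` A = f @` A by exact: clf.
apply/seteqP; split => [x Agx|_ [x Ax <-]] /=; last by rewrite fK.
by exists (g x) => //; rewrite gK.
Qed.

Lemma compact_set_type (X : topologicalType) (A : set X) :
  compact A -> compact [set: A].
Proof.
move=> cA F PF _.
have PG : ProperFilter ((set_val : A -> X) @ F) by exact: fmap_proper_filter.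
have GA : ((set_val : A -> X) @ F) A.
  apply: (@filterS _ F _ [set: A]); last exact: filterT.
  by move=> x _; exact: set_valP.
have [x [Ax clx]] := cA _ PG GA.
exists (exist _ x (mem_set Ax)); split => // B C FB [_ [[V oV <-] /= Vx VC]].
have GB : ((set_val : A -> X) @ F) (set_val @` B).
  by apply: (@filterS _ F _ B) => // b Bb; exists b.
have [_ [[b Bb <-] Vb]] := clx _ V GB (open_nbhs_nbhs (conj oV Vx)).
by exists b; split => //; apply: VC.
Qed.

(** Zero-dimensionality comes from cutting the line at values that [g] misses:
    at such a value the strict and the large inequality define the same set,
    which is therefore both open and closed. *)
Lemma cantor_like_injective_line (R : realType) (T : topologicalType)
    (g : T -> R) :
  continuous g -> injective g -> compact [set: T] ->
  (forall x : T, ~ open [set x]) ->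
  (forall x y, g x < g y -> exists2 z, g x < z < g y & forall t, g t != z) ->
  cantor_like T.
Proof.
move=> cg ig cT iT gap.
have cut z : (forall t, g t != z) -> clopen [set t | g t < z].
  move=> zg; split.
    by rewrite (_ : mkset _ = g @^-1` [set r | r < z])//; apply: open_comp;
      [move=> t _; exact: cg|exact: open_lt].
  rewrite (_ : mkset _ = g @^-1` [set r | r <= z]).
    by apply: closed_comp => [t _|]; [exact: cg|exact: closed_le].
  by apply/seteqP; split => t /=; rewrite le_eqVlt (negbTE (zg t)).
split => //.
- exact/perfectTP.
- move=> x y clxy; apply/ig/(@norm_hausdorff R R) => U V Ux Vy.
  have [t [? ?]] := clxy _ _ (cg _ _ Ux) (cg _ _ Vy).
  by exists (g t).
- move=> x y; have [gxy|gxy|/ig->] := ltgtP (g x) (g y).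
  + have [z /andP[xz zy] zg] := gap _ _ gxy.
    exists [set t | g t < z]; split => //=; first exact: cut.
    by apply/negP; rewrite -leNgt ltW.
  + have [z /andP[xz zy] zg] := gap _ _ gxy.
    exists (~` [set t | g t < z]); split => //=.
      by have := @clopenC _ _ setT (cut _ zg).
      by apply/negP; rewrite -leNgt ltW.
  + by rewrite eqxx.
Qed.

(** Stated for a space [X] mapped injectively into the line, so that it applies
    both to subsets of the line and to subsets of the unit interval taken as a
    type of its own. *)
Lemma cantor_like_subset_line (R : realType) (X : pseudoMetricType R)
    (j : X -> R) (A : set X) :
  continuous j -> injective j -> compact A ->
  (forall x e, A x -> 0 < e -> exists y, [/\ A y, y != x & ball x e y]) ->
  (forall x y, A x -> A y -> j x < j y ->
     exists2 z, j x < z < j y & forall t, A t -> j t != z) ->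
  cantor_like A.
Proof.
move=> cj ij cA iA gap.
apply: (@cantor_like_injective_line R _ (j \o set_val)).
- by move=> x; apply: continuous_comp; [exact: initial_continuous|exact: cj].
- by move=> x y /ij /val_inj.
- exact: compact_set_type.
- move=> x [V oV Vx].
  have /nbhs_ballP[e e0 eV] : nbhs (set_val x) V.
    by apply: open_nbhs_nbhs; split => //; have : [set x] x by []; rewrite -Vx.
  have [y [Ay /eqP yx xey]] := iA _ _ (set_valP x) e0.
  apply: yx; have : [set x] (exist _ y (mem_set Ay)) by rewrite -Vx; exact: eV.
  by move=> /(congr1 set_val).
- move=> x y xy; have [z xzy zA] := gap _ _ (set_valP x) (set_valP y) xy.
  by exists z => // t; apply: zA; exact: set_valP.
Qed.

Lemma expr_lt_eps (R : realType) (q e : R) :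
  0 < q < 1 -> 0 < e -> exists n, q ^+ n < e.
Proof.
move=> /andP[q0 q1] e0.
have q1' : `|q| < 1 by rewrite ger0_norm// ltW.
have /cvgrPdist_lt/(_ _ e0)[n _ /(_ n (leqnn n))] := cvg_expr q1'.
by rewrite sub0r normrN ger0_norm ?exprn_ge0 ?ltW//; exists n.
Qed.

Section ternary.
Variable R : realType.
Local Notation K := (ternary_cantor_set R).

Lemma ternary_step_unit n (x : R) : ternary_step n x -> 0 <= x <= 1.
Proof.
elim: n x => [x /=|n IH x /= [] [t /IH t01 <-]]; first by rewrite in_itv.
  by lra.
by lra.
Qed.

Lemma ternary_stepSE n (x : R) : ternary_step n.+1 x <->
  ternary_step n (3 * x) \/ ternary_step n (3 * x - 2).
Proof.
split=> [[[t tn <-]|[t tn <-]]|[tn|tn]].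
- by left; rewrite mulrC divfK.
- by right; rewrite mulrC divfK// addrK.
- by left; exists (3 * x) => //; rewrite mulrC mulKf.
- by right; exists (3 * x - 2) => //; rewrite subrK mulrC mulKf.
Qed.

Lemma ternary_cantor_unit (x : R) : K x -> 0 <= x <= 1.
Proof. by move=> /(_ 0%N I)/ternary_step_unit. Qed.

(** All the stages have to choose the same third, because 1/2 separates the
    two outer thirds. *)
Lemma ternary_cantor_setE (x : R) : K x <-> K (3 * x) \/ K (3 * x - 2).
Proof.
split=> [Kx|].
  have step n := (ternary_stepSE n x).1 (Kx n.+1 I).
  have [xle|xgt] := leP x 2^-1.
    by left => n _; case: (step n) => // /ternary_step_unit; lra.
  by right => n _; case: (step n) => // /ternary_step_unit; lra.
move=> KK; have x01 : 0 <= x <= 1 by case: KK => /ternary_cantor_unit; lra.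
case=> [|n] _ /=; first by rewrite in_itv.
by apply/ternary_stepSE; case: KK => /(_ n I); [left|right].
Qed.

Lemma ternary_cantor0 : K 0.
Proof.
case=> [|n] _; first by rewrite /= in_itv /= lexx ler01.
elim: n => [|n IH]; apply/ternary_stepSE; left; rewrite mulr0 //.
by rewrite /= in_itv /= lexx ler01.
Qed.

Lemma ternary_cantor1 : K 1.
Proof.
have -> : 1 = 3 * 1 - 2 :> R by ring.
case=> [|n] _; first by rewrite /= in_itv /=; lra.
elim: n => [|n IH]; apply/ternary_stepSE; right.
  by rewrite /= in_itv /=; lra.
by have <- : 3 * 1 - 2 = 3 * (3 * 1 - 2) - 2 :> R by ring.
Qed.

Lemma closed_ternary_step n : closed (@ternary_step R n).
Proof.
elim: n => [|n IH]; first exact: itv_closed.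
rewrite (_ : ternary_step n.+1 =
    (fun x => 3 * x) @^-1` ternary_step n `|`
    (fun x => 3 * x - 2) @^-1` ternary_step n); last first.
  by apply/seteqP; split => x /ternary_stepSE.
apply: closedU; apply: closed_comp => // x _.
  exact: mulrl_continuous.
by apply: continuousB; [exact: mulrl_continuous|exact: cst_continuous].
Qed.

Lemma compact_ternary_cantor : compact K.
Proof.
apply: (subclosed_compact _ (@segment_compact _ 0 1)).
  by apply: closed_bigI => n _; exact: closed_ternary_step.
by move=> x /(_ 0%N I).
Qed.

(** The two endpoints serve at scale 0, and self-similarity carries the pair of
    nearby points down to the smaller scales. *)
Lemma ternary_cantor_near n (x : R) : K x ->
  exists y, [/\ K y, y != x & `|x - y| <= 3^-1 ^+ n].
Proof.
elim: n x => [|n IH] x Kx.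
  have x01 := ternary_cantor_unit Kx.
  have [->|x0] := eqVneq x 0.
    exists 1; split; [exact: ternary_cantor1|exact: oner_neq0|].
    by rewrite sub0r normrN1 expr0.
  exists 0; split; [exact: ternary_cantor0|by rewrite eq_sym|].
  by rewrite subr0 expr0 ger0_norm; lra.
have [/IH[y [Ky yx xy]]|/IH[y [Ky yx xy]]] := (ternary_cantor_setE x).1 Kx.
- exists (y / 3); split.
  + by apply/ternary_cantor_setE; left; rewrite mulrC divfK.
  + by apply: contra_neq yx => <-; rewrite mulrC divfK.
  + rewrite (_ : x - y / 3 = 3^-1 * (3 * x - y)); last by field.
    by rewrite normrM ger0_norm ?invr_ge0// exprS ler_wpM2l ?invr_ge0.
- exists ((y + 2) / 3); split.
  + by apply/ternary_cantor_setE; right; rewrite mulrC divfK// addrK.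
  + by apply: contra_neq yx => <-; rewrite mulrC divfK// addrK.
  + rewrite (_ : x - (y + 2) / 3 = 3^-1 * (3 * x - 2 - y)); last by field.
    by rewrite normrM ger0_norm ?invr_ge0// exprS ler_wpM2l ?invr_ge0.
Qed.

(** Two points of the same third are moved apart by a factor 3 by the
    self-similarity; two points of different thirds are separated by 1/2. *)
Lemma ternary_cantor_gap n (x y : R) : K x -> K y -> 3^-1 ^+ n < y - x ->
  exists2 z, x < z < y & ~ K z.
Proof.
elim: n x y => [|n IH] x y Kx Ky.
  move: (ternary_cantor_unit Kx) (ternary_cantor_unit Ky); rewrite expr0; lra.
rewrite exprS ltr_pdivrMl// => nxy.
have [|Kx'] := (ternary_cantor_setE x).1 Kx;
  have [|Ky'] := (ternary_cantor_setE y).1 Ky.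
- move=> Ky' Kx'.
  have [|z xzy Kz] := IH _ _ Kx' Ky'; first by rewrite -mulrBr.
  have xy1 := ternary_cantor_unit Ky'.
  exists (z / 3); first by lra.
  move=> /ternary_cantor_setE; rewrite mulrC divfK// => -[//|].
  by move=> /ternary_cantor_unit; lra.
- move=> Kx'; have x1 := ternary_cantor_unit Kx'.
  have y1 := ternary_cantor_unit Ky'.
  exists 2^-1; first by lra.
  by move=> /ternary_cantor_setE[|] /ternary_cantor_unit; lra.
- move=> Ky'; have p : 0 < 3^-1 ^+ n :> R by apply: exprn_gt0; lra.
  by move: (ternary_cantor_unit Kx') (ternary_cantor_unit Ky'); lra.
- have [|z xzy Kz] := IH _ _ Kx' Ky'; first by lra.
  have xy1 := ternary_cantor_unit Kx'.
  exists ((z + 2) / 3); first by lra.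
  move=> /ternary_cantor_setE; rewrite mulrC divfK// addrK => -[|//].
  by move=> /ternary_cantor_unit; lra.
Qed.

Lemma cantor_like_ternary : cantor_like K.
Proof.
apply: (@cantor_like_subset_line R R id).
- by move=> x; exact: cvg_id.
- by [].
- exact: compact_ternary_cantor.
- move=> x e Kx e0; have [|n ne] := @expr_lt_eps R 3^-1 e _ e0; first by lra.
  have [y [Ky yx xy]] := ternary_cantor_near n Kx.
  by exists y; split => //; exact: le_lt_trans ne.
- move=> x y Kx Ky xy; have yx0 : 0 < y - x by rewrite subr_gt0.
  have [|n ne] := @expr_lt_eps R 3^-1 _ _ yx0; first by lra.
  have [z xzy Kz] := ternary_cantor_gap Kx Ky ne.
  by exists z => // t Kt; apply/eqP => tz; apply: Kz; rewrite -tz.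
Qed.

End ternary.

Lemma is_cantor_set_cantor_like (R : realType) (A : set (unit_interval R)) :
  A !=set0 -> cantor_like A -> is_cantor_set A.
Proof.
move=> [x Ax] cA; rewrite /is_cantor_set.
apply: (@homeomorphic_trans _ cantor_space).
  exact/homeomorphic_sym/(cantor_like_homeomorphic_cantor_space
    (exist _ x (mem_set Ax) : set_type A) cA).
exact (@cantor_like_homeomorphic_cantor_space R _
  (exist _ 0 (mem_set (@ternary_cantor0 R)) : set_type (ternary_cantor_set R))
  (cantor_like_ternary R)).
Qed.

(** * A function all of whose level sets are perfect *)

Section gillis.
Variable R : realType.
Implicit Types (h : R -> R) (x t : R).

Lemma le_geometric_le0 (x : R) : (forall n, x <= 2 * 2^-1 ^+ n) -> x <= 0.
Proof.
move=> xn; have [//|x0] := leP x 0.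
have [||n nx] := @expr_lt_eps _ 2^-1 (x / 2); [lra|lra|].
by have := xn n; lra.
Qed.

Lemma le_geometric_eq0 (x : R) : (forall n, `|x| <= 2 * 2^-1 ^+ n) -> x = 0.
Proof.
by move=> xn; apply/normr0_eq0/le_anti; rewrite normr_ge0 le_geometric_le0.
Qed.

(** The factor 2 in the error bound is the sum of the geometric series. *)
Lemma geometric_uniform_limit (f : nat -> R -> R) :
  (forall n, continuous (f n)) ->
  (forall n x, `|f n.+1 x - f n x| <= 2^-1 ^+ n) ->
  exists2 F : R -> R, continuous F &
    forall n x, `|F x - f n x| <= 2 * 2^-1 ^+ n.
Proof.
move=> cf df.
have dnk n k x :
    `|f (n + k)%N x - f n x| <= 2 * 2^-1 ^+ n - 2 * 2^-1 ^+ (n + k).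
  elim: k => [|k IH]; first by rewrite addn0 !subrr normr0.
  have := df (n + k)%N x; rewrite addnS exprS.
  have := ler_normD (f (n + k).+1 x - f (n + k)%N x) (f (n + k)%N x - f n x).
  by rewrite addrA subrK; lra.
have dn n k x : `|f (n + k)%N x - f n x| <= 2 * 2^-1 ^+ n.
  apply: le_trans (dnk _ _ _) _; rewrite gerBl mulr_ge0// exprn_ge0//.
have cvgf x : cvgn (f ^~ x).
  apply/cauchy_cvgP/cauchy_exP => e e0.
  have [||n ne] := @expr_lt_eps _ 2^-1 (e / 2); [lra|lra|].
  exists (f n x); exists n => // m /= nm; rewrite /ball /= distrC -(subnKC nm).
  by apply: le_lt_trans (dn _ _ _) _; lra.
have FE n x : `|limn (f ^~ x) - f n x| <= 2 * 2^-1 ^+ n.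
  have cn : (fun m => `|f m x - f n x|) @ \oo --> `|limn (f ^~ x) - f n x|.
    by apply: cvg_norm; apply: cvgB; [exact: cvgf|exact: cvg_cst].
  rewrite -(cvg_lim _ cn)//; apply: limr_le.
    by apply/cvg_ex; eexists; exact: cn.
  by exists n => // m /= nm; rewrite -(subnKC nm).
exists (fun x => limn (f ^~ x)) => // x; apply/cvgrPdist_lt => e e0.
have [||n ne] := @expr_lt_eps _ 2^-1 (e / 6); [lra|lra|].
have e3 : 0 < e / 3 by rewrite divr_gt0.
have /cvgrPdist_lt/(_ _ e3) := cf n x.
apply: filterS => y; have := FE n x; have := FE n y.
have := ler_distD (f n x) (limn (f ^~ x)) (limn (f ^~ y)).
have := ler_distD (f n y) (f n x) (limn (f ^~ y)).
by rewrite (distrC (f n y) (limn _)); lra.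
Qed.

(** Functions that continue by their end values outside the unit interval: this
    makes the piecewise definition below a plain sum, with no case analysis and
    no continuity to check at the break points. *)
Definition saturated h :=
  (forall x, x <= 0 -> h x = 0) /\ (forall x, 1 <= x -> h x = 1).

(** Signed size of the [j]-th copy: up, down, up, up, down, up. *)
Definition slope (j : nat) : R := if j \in [:: 1; 4]%N then - 2^-1 else 2^-1.

(** On the [i]-th sixth of the unit interval the summands before the [i]-th are
    saturated at 1 and those after it vanish, so only the [i]-th one moves. *)
Definition zigzag h x := \sum_(0 <= j < 6) slope j * h (6 * x - j%:R).

Lemma zigzag_piece h i t : saturated h -> (i < 6)%N -> 0 <= t <= 1 ->
  zigzag h ((i%:R + t) / 6) = \sum_(0 <= j < i) slope j + slope i * h t.
Proof.
move=> [h0 h1] i6 t01; rewrite /zigzag (big_cat_nat (leq0n i) (ltnW i6)) /=.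
rewrite (big_ltn i6) (big_nat _ _ i.+1).
rewrite [X in _ + (_ + X)]big1 ?addr0; last first.
  move=> j /andP[ij _].
  rewrite h0 ?mulr0// mulrC divfK//.
  by have : (i.+1%:R <= j%:R :> R); [rewrite ler_nat|rewrite -natr1; lra].
congr (_ + _ * h _); last by rewrite mulrC divfK// addrC addKr.
apply: eq_big_nat => j /andP[_ ji]; rewrite h1 ?mulr1// mulrC divfK//.
by have : (j.+1%:R <= i%:R :> R); [rewrite ler_nat|rewrite -natr1; lra].
Qed.

Lemma unit_piece x : 0 <= x <= 1 ->
  exists i t, [/\ (i < 6)%N, 0 <= t <= 1 & x = (i%:R + t) / 6].
Proof.
move=> x01; have [->|x1] := eqVneq x 1.
  by exists 5, 1; split => //; lra.
have {}x1 : x < 1 by rewrite lt_neqAle x1; case/andP: x01.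
have x0 : 0 <= 6 * x by lra.
exists (Num.truncn (6 * x)), (6 * x - (Num.truncn (6 * x))%:R).
have /andP[l u] := truncn_itv x0.
split; last by field.
  by rewrite -(ltr_nat R); apply: le_lt_trans l _; lra.
by move: u; rewrite -(natr1 (Num.truncn _)); lra.
Qed.

Lemma saturated_zigzag h : saturated h -> saturated (zigzag h).
Proof.
move=> [h0 h1]; split => x xle; rewrite /zigzag.
  by rewrite big1// => j _; rewrite h0 ?mulr0//; have := ler0n R j; lra.
transitivity (\sum_(0 <= j < 6) slope j).
  apply: eq_big_nat => j /andP[_ ji]; rewrite h1 ?mulr1//.
  have : (j%:R <= 5 :> R) by rewrite ler_nat.
  by lra.
by rewrite /slope unlock /=; lra.
Qed.

Lemma norm_slope j : `|slope j| = 2^-1.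
Proof. by rewrite /slope; case: ifP; rewrite ?normrN ger0_norm. Qed.

(** At each point only one summand varies, so the factor is that of a single
    slope and not the sum of six of them. *)
Lemma zigzag_contraction h g e : saturated h -> saturated g ->
  (forall x, `|h x - g x| <= e) ->
  forall x, `|zigzag h x - zigzag g x| <= e / 2.
Proof.
move=> sh sg hg x; have e0 : 0 <= e by exact: le_trans (hg 0).
have [h0 h1] := saturated_zigzag sh; have [g0 g1] := saturated_zigzag sg.
have [x0|x0] := leP x 0; first by rewrite h0// g0// subrr normr0; lra.
have [x1|x1] := leP 1 x; first by rewrite h1// g1// subrr normr0; lra.
have [|i [t [i6 t01 ->]]] := @unit_piece x; first by lra.
rewrite !zigzag_piece// opprD addrACA subrr add0r -mulrBr normrM norm_slope.
by rewrite mulrC ler_wpM2r// invr_ge0.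
Qed.

Lemma zigzag_unit h : saturated h -> (forall x, 0 <= h x <= 1) ->
  forall x, 0 <= zigzag h x <= 1.
Proof.
move=> sh h01 x; have [z0 z1] := saturated_zigzag sh.
have [x0|x0] := leP x 0; first by rewrite z0//; lra.
have [x1|x1] := leP 1 x; first by rewrite z1//; lra.
have [|i [t [i6 t01 ->]]] := @unit_piece x; first by lra.
rewrite zigzag_piece//; have := h01 t.
by case: i i6 => [|[|[|[|[|[|]]]]]] // _; rewrite /slope unlock /=; lra.
Qed.

Lemma continuous_zigzag h : continuous h -> continuous (zigzag h).
Proof.
move=> ch x; rewrite /zigzag; apply: cvg_big => [|j _].
  exact: add_continuous.
apply: cvgM; first exact: cvg_cst.
apply: continuous_comp; last exact: ch.
by apply: cvgB; [exact: mulrl_continuous|exact: cvg_cst].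
Qed.

(** The iterates from the clamped identity converge uniformly, since the
    operator halves distances. *)
Lemma gillis_exists : exists F : R -> R,
  [/\ continuous F, saturated F, forall x, 0 <= F x <= 1 & zigzag F = F].
Proof.
pose f n := iter n zigzag (fun x : R => Num.max 0 (Num.min x 1)).
have sf n : saturated (f n).
  elim: n => [|n]; last exact: saturated_zigzag.
  by split => x x0 /=; rewrite /Num.min /Num.max; repeat case: ifPn; lra.
have cf n : continuous (f n).
  elim: n => [|n]; last exact: continuous_zigzag.
  move=> x /=; apply: (@continuous_max R R (cst 0) (fun y => Num.min y 1)).
    exact: cst_continuous.
  apply: (@continuous_min R R id (cst 1)); first exact: cvg_id.
  exact: cst_continuous.
have f01 n x : 0 <= f n x <= 1.
  elim: n x => [x|n IH]; last by apply: zigzag_unit.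
  by rewrite /= /Num.min /Num.max; repeat case: ifPn; lra.
have [|F cF Ff] := geometric_uniform_limit cf.
  elim=> [|n IH] x.
    by rewrite expr0 ler_norml; have := f01 0%N x; have := f01 1%N x; lra.
  rewrite exprSr; apply: zigzag_contraction.
  - exact: sf n.+1.
  - exact: sf n.
  - exact: IH.
have sF : saturated F.
  have h0 n x : x <= 0 -> f n x = 0 by case: (sf n) => + _; apply.
  have h1 n x : 1 <= x -> f n x = 1 by case: (sf n) => _; apply.
  split=> x xle; apply: subr0_eq; apply: le_geometric_eq0 => n.
    by have := Ff n x; rewrite h0.
  by have := Ff n x; rewrite h1.
exists F; split => //.
  move=> x; have F0 : - F x <= 0.
    apply: le_geometric_le0 => n; have := f01 n x; have := Ff n x.
    by rewrite ler_norml; lra.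
  have F1 : F x - 1 <= 0; last by lra.
  apply: le_geometric_le0 => n; have := f01 n x; have := Ff n x.
  by rewrite ler_norml; lra.
apply/funext => x; apply: subr0_eq; apply: le_geometric_eq0 => n.
have zF : `|zigzag F x - f n.+2 x| <= 2 * 2^-1 ^+ n.+1 / 2.
  exact: zigzag_contraction sF (sf n.+1) (Ff n.+1) x.
have := ler_distD (f n.+2 x) (zigzag F x) (F x); rewrite (distrC (f n.+2 x)).
have := Ff n.+2 x; have : 0 <= 2^-1 ^+ n :> R by rewrite exprn_ge0.
by move: zF; rewrite !exprS; lra.
Qed.

Section levels.
Variable F : R -> R.
Hypothesis sF : saturated F.
Hypothesis zF : zigzag F = F.

Lemma gillis_piece i t : (i < 6)%N -> 0 <= t <= 1 ->
  F ((i%:R + t) / 6) = \sum_(0 <= j < i) slope j + slope i * F t.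
Proof. by move=> i6 t01; rewrite -[in LHS]zF zigzag_piece. Qed.

Lemma unit_pieceK i t : (i < 6)%N -> 0 <= t <= 1 ->
  0 <= (i%:R + t) / 6 <= 1.
Proof.
move=> i6 t01; have i0 := ler0n R i.
have i5 : i%:R <= 5 :> R by rewrite ler_nat.
lra.
Qed.

Lemma dist_piece i x y e : `|x - y| <= e ->
  `|(i%:R + x) / 6 - (i%:R + y) / 6| <= 6^-1 * e.
Proof.
move=> xy; rewrite (_ : _ - _ = (x - y) * 6^-1); last by ring.
rewrite normrM mulrC (ger0_norm (_ : 0 <= 6^-1)) ?invr_ge0//.
by rewrite ler_wpM2l// invr_ge0.
Qed.

Lemma gillis_oscillation n x : 0 <= x <= 1 -> exists u v,
  [/\ 0 <= u <= 1, 0 <= v <= 1, `|x - u| <= 6^-1 ^+ n,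
      `|x - v| <= 6^-1 ^+ n & F u != F v].
Proof.
elim: n x => [x x01|n IH _ /unit_piece[i [t [i6 t01 ->]]]].
  exists 0, 1; split; rewrite ?expr0 ?ler_norml; [lra..|].
  by rewrite sF.1// sF.2// eq_sym oner_neq0.
have [u [v [u01 v01 tu tv Fuv]]] := IH _ t01.
exists ((i%:R + u) / 6), ((i%:R + v) / 6); rewrite exprS.
split; [exact: unit_pieceK|exact: unit_pieceK|exact: dist_piece..|].
rewrite !gillis_piece//; apply: contra_neq Fuv => /addrI /mulfI; apply.
by rewrite -normr_eq0 norm_slope.
Qed.

Hypothesis cF : continuous F.
Hypothesis F01 : forall x, 0 <= F x <= 1.

(** Each value is taken on two of the six pieces that are not adjacent, hence
    at two distinct points, one of which differs from [x].  This is the scale 0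
    case; inside a piece the function is an affine copy of itself. *)
Lemma gillis_level_near n x : 0 <= x <= 1 -> exists y,
  [/\ 0 <= y <= 1, y != x, `|x - y| <= 6^-1 ^+ n & F y = F x].
Proof.
have onto w : 0 <= w <= 1 -> exists2 t, 0 <= t <= 1 & F t = w.
  move=> w01; have [|||t t01 <-] := @IVT R F 0 1 w.
  - by [].
  - exact: continuous_subspaceT.
  - by rewrite sF.1// sF.2// /Num.min /Num.max ltr01.
  - by exists t => //; rewrite in_itv in t01.
(* Needed for [i = 0] and [i = 3], where the pieces [i] and [i.+2] both run
   upwards through the same values. *)
have twice i : (i < 4)%N -> forall x t, 0 <= x <= 1 -> 0 <= t <= 1 ->
    F ((i%:R + t) / 6) = F x -> F ((i.+2%:R + t) / 6) = F x ->
    exists y, [/\ 0 <= y <= 1, y != x, `|x - y| <= 6^-1 ^+ 0 & F y = F x].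
  move=> i4 {}x t x01 t01 E1 E2.
  have i6 : (i < 6)%N by exact: leq_trans i4 _.
  have [xE|xE] := eqVneq ((i%:R + t) / 6) x.
    exists ((i.+2%:R + t) / 6); have y01 := @unit_pieceK i.+2 t i4 t01.
    split => //; last by rewrite expr0 ler_norml; lra.
    by rewrite -xE -addn2 natrD; apply/eqP; lra.
  exists ((i%:R + t) / 6); have y01 := @unit_pieceK i t i6 t01.
  by split => //; rewrite expr0 ler_norml; lra.
elim: n x => [x x01|n IH _ /unit_piece[i [t [i6 t01 ->]]]].
  have [Fx|Fx] := leP (F x) 2^-1.
    have [|t t01 Ft] := onto (2 * F x); first by have := F01 x; lra.
    by apply: (@twice 0%N isT x t) => //; rewrite gillis_piece// Ft;
      rewrite /slope unlock /=; lra.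
  have [|t t01 Ft] := onto (2 * F x - 1); first by have := F01 x; lra.
  by apply: (@twice 3 isT x t) => //; rewrite gillis_piece// Ft;
    rewrite /slope unlock /=; lra.
have [y [y01 yt ty Fy]] := IH _ t01.
exists ((i%:R + y) / 6); rewrite exprS; split.
- exact: unit_pieceK.
- apply: contra_neq yt; lra.
- exact: dist_piece.
- by rewrite !gillis_piece// Fy.
Qed.

End levels.

Lemma gillis_function : exists F : R -> R,
  [/\ continuous F, forall x, 0 <= F x <= 1,
      forall x e, 0 <= x <= 1 -> 0 < e ->
        exists y, [/\ 0 <= y <= 1, y != x, `|x - y| < e & F y = F x]
    & forall a b, 0 <= a -> a < b -> b <= 1 ->
        exists u v, [/\ a <= u <= b, a <= v <= b & F u < F v]].
Proof.
have [F [cF sF F01 zF]] := gillis_exists.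
exists F; split => //.
- move=> x e x01 e0; have [||n ne] := @expr_lt_eps _ 6^-1 e; [lra|lra|].
  have [y [y01 yx xy Fyx]] := gillis_level_near sF zF cF F01 n x01.
  by exists y; split => //; exact: le_lt_trans ne.
- move=> a b a0 ab b1.
  have [||n ne] := @expr_lt_eps _ 6^-1 ((b - a) / 2); [lra|lra|].
  have [|u [v []]] := @gillis_oscillation _ sF zF n ((a + b) / 2); first by lra.
  rewrite !ler_norml => u01 v01 ul vl.
  have [uv|uv|//] := ltgtP (F u) (F v).
    by exists u, v; split => //; lra.
  by exists v, u; split => //; lra.
Qed.

End gillis.

(** * Exponential sums on an interval *)

Lemma is_derive_expsum (R : realType) (I : Type) (r : seq I) (c gam : I -> R)
    (t : R) :
  is_derive t 1 (fun t : R => \sum_(i <- r) c i * expR (gam i * t))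
    (\sum_(i <- r) c i * gam i * expR (gam i * t)).
Proof.
elim: r => [|i r IH].
  by under eq_fun do rewrite big_nil; rewrite big_nil; exact: is_derive_cst.
under eq_fun do rewrite big_cons; rewrite big_cons.
apply: is_deriveD => /=.
have H : is_derive t 1 (fun t : R => expR (gam i * t))
    (gam i * expR (gam i * t)).
  have D : is_derive t 1 (fun t : R => gam i * t) (gam i).
    by apply: is_derive_eq; rewrite /GRing.scale /=; ring.
  have E := is_derive_expR (gam i * t).
  have := @is_derive1_comp R expR (fun t : R => gam i * t) t _ _ E D.
  by rewrite mulrC.
have := @is_deriveZ R R R (fun t : R => expR (gam i * t)) (c i) t 1 _ H.
by rewrite /GRing.scale /= mulrA.
Qed.

Lemma derive_expsum_cst (R : realType) (I : Type) (r : seq I) (c gam : I -> R)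
    (a b k : R) :
  (forall t, a < t < b -> \sum_(i <- r) c i * expR (gam i * t) = k) ->
  forall t, a < t < b -> \sum_(i <- r) c i * gam i * expR (gam i * t) = 0.
Proof.
move=> ck t tab.
have [_ <-] := is_derive_expsum r c gam t.
rewrite (@near_eq_derive R R R _ (cst k)) ?derive_cst//.
have : t \in `]a, b[ by rewrite in_itv.
move=> /near_in_itvoo; by apply: filterS => u; rewrite in_itv => /ck ->.
Qed.

(** Dividing by one exponential and differentiating removes one term, keeps the
    exponents distinct and multiplies the other coefficients by nonzero
    differences of exponents. *)
Lemma expsum_eq0 (R : realType) (I : eqType) (r : seq I) (c gam : I -> R)
    (a b : R) :
  a < b -> uniq [seq gam i | i <- r] ->
  (forall t, a < t < b -> \sum_(i <- r) c i * expR (gam i * t) = 0) ->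
  forall i, i \in r -> c i = 0.
Proof.
move=> ab; elim: r c gam => // j r IH c gam /= /andP[jr ur] c0.
have cr i : i \in r -> c i = 0.
  move=> ir; have : c i * (gam i - gam j) = 0.
    apply: (IH (fun i => c i * (gam i - gam j)) (fun i => gam i - gam j)) => //.
      rewrite (map_comp (fun x => x - gam j) gam) map_inj_uniq//.
      exact: addIr.
    apply: (@derive_expsum_cst _ _ _ _ _ _ _ (- c j)) => t tab.
    have := c0 _ tab; rewrite big_cons => /eqP.
    rewrite addrC addr_eq0 => /eqP E.
    transitivity (expR (- (gam j * t)) * \sum_(i <- r) c i * expR (gam i * t)).
      rewrite mulr_sumr; apply: eq_bigr => l _.
      by rewrite mulrBl expRD; ring.
    by rewrite E mulrN mulrCA -expRD addNr expR0 mulr1.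
  move=> /eqP; rewrite mulf_eq0 subr_eq0 => /orP[/eqP//|/eqP gij].
  by case/negP: jr; rewrite -gij map_f.
move=> i; rewrite inE => /orP[/eqP ->|/cr//].
have /c0 : a < (a + b) / 2 < b by lra.
rewrite big_cons big_seq big1 => [|l /cr ->]; last by rewrite mul0r.
by rewrite addr0 => /eqP; rewrite mulf_eq0 (gt_eqF (expR_gt0 _)) orbF => /eqP.
Qed.

(** A constant sum has a vanishing derivative, whose coefficients are those of
    the sum multiplied by their exponents; this is why one nonzero exponent with
    a nonzero coefficient is enough. *)
Lemma expsum_nonconst (R : realType) (I : eqType) (r : seq I) (c gam : I -> R)
    (i : I) :
  i \in r -> c i != 0 -> uniq [seq gam i | i <- r] -> gam i != 0 ->
  forall a b k, a < b ->
  exists2 t, a < t < b & \sum_(i <- r) c i * expR (gam i * t) != k.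
Proof.
move=> ir ci ug gi a b k ab; apply: contrapT => no.
have /derive_expsum_cst/(expsum_eq0 ab ug)/(_ i ir)/eqP : forall t, a < t < b ->
    \sum_(i <- r) c i * expR (gam i * t) = k.
  by move=> t tab; apply/eqP/negPn/negP => tk; apply: no; exists t.
by rewrite mulf_eq0 (negbTE ci) (negbTE gi).
Qed.

Lemma continuous_expsum (R : realType) (I : Type) (r : seq I) (c gam : I -> R) :
  continuous (fun t : R => \sum_(i <- r) c i * expR (gam i * t)).
Proof.
move=> t; apply: differentiable_continuous; apply/derivable1_diffP.
by have [] := is_derive_expsum r c gam t.
Qed.

(** * Linearly independent exponents *)

Section factorial_expansion.
Variables (R : realType) (D : nat -> int) (M : nat).
Hypothesis DM : forall m, `|(D m)%:~R| <= M%:R :> R.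

Let S n : R := \sum_(0 <= m < n) (D m)%:~R / m`!%:R.

Lemma factorial_expansion_int n : exists z : int, n`!%:R * S n.+1 = z%:~R.
Proof.
elim: n => [|n [z IH]].
  by exists (D 0%N); rewrite /S big_nat1 mul1r fact0 divr1.
exists (n.+1%:Z * z + D n.+1); rewrite /S big_nat_recr//= -/(S n.+1).
rewrite mulrDr mulrCA divff ?mulr1; last by rewrite pnatr_eq0 -lt0n fact_gt0.
by rewrite factS natrM -mulrA IH rmorphD rmorphM.
Qed.

(** The bound telescopes, since [1 / p`! <= 2 / p`! - 2 / p.+1`!] for
    [p >= 1]. *)
Lemma factorial_expansion_tail n k : (0 < n)%N ->
  `|S (n + k) - S n| <= M%:R * (2 / n`!%:R - 2 / (n + k)`!%:R).
Proof.
move=> n0; elim: k => [|k IH]; first by rewrite addn0 !subrr normr0 mulr0.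
rewrite addnS [S _]big_nat_recr//= -/(S (n + k)) addrAC.
apply: le_trans (ler_normD _ _) _.
set p := (n + k)%N in IH *.
have p0 : 0 < p`!%:R :> R by rewrite ltr0n fact_gt0.
have D1 : `|(D p)%:~R / p`!%:R| <= M%:R * p`!%:R^-1 :> R.
  by rewrite normrM normfV (ger0_norm (ltW p0)) ler_wpM2r// invr_ge0 ltW.
have D2 : M%:R * (2 / p.+1`!%:R) <= M%:R * p`!%:R^-1 :> R.
  apply: ler_wpM2l => //; rewrite factS natrM invfM mulrA.
  rewrite ler_piMl ?invr_ge0 ?(ltW p0)// ler_pdivrMr ?ltr0n// mul1r ler_nat.
  by rewrite ltnS /p addn_gt0 n0.
move: D1 D2 IH; rewrite !mulrBr; lra.
Qed.

(** With sum 0, the partial sums are bounded by their tails; multiplied by the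
    common denominator they are integers of absolute value at most
    [2 * M / n.+1], hence zero as soon as [n.+1] exceeds [2 * M]. *)
Lemma factorial_expansion_eq0 : S n @[n --> \oo] --> (0 : R) ->
  forall m, (2 * M < m)%N -> D m = 0.
Proof.
move=> S0.
have Sn n : (0 < n)%N -> `|S n| <= M%:R * (2 / n`!%:R).
  move=> n0; have cS : `|S k - S n| @[k --> \oo] --> `|0 - S n|.
    by apply: cvg_norm; apply: cvgB => //; exact: cvg_cst.
  rewrite -normrN -sub0r -(cvg_lim _ cS)//.
  apply: limr_le; first by apply/cvg_ex; eexists; exact: cS.
  exists n => // k /= nk; rewrite -(subnKC nk).
  apply: le_trans (factorial_expansion_tail _ n0) _.
  by rewrite ler_wpM2l// gerBl divr_ge0.
have S_eq0 n : (2 * M < n.+1)%N -> S n.+1 = 0.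
  move=> Mn; have [z zE] := factorial_expansion_int n.
  have n0 : 0 < n`!%:R :> R by rewrite ltr0n fact_gt0.
  have : `|z%:~R| < 1 :> R.
    rewrite -zE normrM (ger0_norm (ltW n0)).
    apply: (@le_lt_trans _ _ (n`!%:R * (M%:R * (2 / n.+1`!%:R)))).
      by rewrite ler_wpM2l// ?(ltW n0)// Sn.
    rewrite (_ : _ * _ = (2 * M)%:R / n.+1%:R); last first.
      rewrite factS !natrM; move: n.+1%:R (ltr0Sn R n) => p p0.
      by field; rewrite !gt_eqF.
    by rewrite ltr_pdivrMr ?ltr0n// mul1r ltr_nat.
  rewrite -intr_norm ltrz1 => z1; have z0 : z = 0 by lia.
  by move/eqP: zE; rewrite z0 mulf_eq0 (gt_eqF n0) => /eqP.
move=> m Mm; have := S_eq0 _ (leqW Mm); rewrite /S big_nat_recr//= -/(S m).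
case: m Mm => // m Mm; rewrite S_eq0// add0r => /eqP.
rewrite mulf_eq0 invr_eq0 pnatr_eq0 -leqn0 leqNgt fact_gt0 orbF.
by rewrite intr_eq0 => /eqP.
Qed.

End factorial_expansion.

Definition prefix_code (s : nat -> bool) (n : nat) : nat := pickle (mkseq s n).

(** Indicator of the set of codes of the finite prefixes of [s]; for distinct
    sequences these sets are infinite with finite intersection. *)
Definition codes_prefix (s : nat -> bool) (m : nat) : bool :=
  if unpickle m is Some l then l == mkseq s (size l) else false.

Lemma codes_prefixE s n : codes_prefix s (prefix_code s n).
Proof. by rewrite /codes_prefix pickleK size_mkseq. Qed.

Lemma codes_prefix_eventually_neq (s s' : nat -> bool) : s <> s' ->
  exists N, forall n, (N <= n)%N -> codes_prefix s' (prefix_code s n) = false.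
Proof.
move=> ss'; have [j sj] : exists j, s j <> s' j.
  by apply/existsNP => E; apply: ss'; apply/funext.
exists j.+1 => n jn; rewrite /codes_prefix pickleK size_mkseq; apply/eqP => E.
by apply: sj; rewrite -(nth_mkseq true s jn) E nth_mkseq.
Qed.

Lemma prefix_code_unbounded s N B :
  exists2 n, (N <= n)%N & (B < prefix_code s n)%N.
Proof.
apply: contrapT => no.
have small n : (N <= n)%N -> (prefix_code s n < B.+1)%N.
  by move=> Nn; rewrite ltnNge; apply/negP => Bn; apply: no; exists n.
have inj : injective (prefix_code s).
  move=> n n' /(pcan_inj pickleK) /(congr1 size).
  by rewrite !size_mkseq.
have U : uniq (map (prefix_code s) (iota N B.+2)).
  by rewrite map_inj_uniq ?iota_uniq.
have : (size (map (prefix_code s) (iota N B.+2)) <= size (iota 0 B.+1))%N.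
  apply: uniq_leq_size => // _ /mapP[n + ->].
  by rewrite !mem_iota add0n => /andP[Nn _]; exact: small.
by rewrite size_map !size_iota ltnn.
Qed.

Section exponents.
Variable R : realType.

Let term (s : nat -> bool) (m : nat) : R := (codes_prefix s m)%:R / m`!%:R.

Definition exponent (s : nat -> bool) : R := limn (series (term s)).

Lemma cvg_exponent s : series (term s) n @[n --> \oo] --> exponent s.
Proof.
apply: (@series_le_cvg _ _ (exp_coeff (1 : R))).
- by move=> n; rewrite divr_ge0.
- by move=> n; rewrite /exp_coeff /= expr1n divr_ge0.
- by move=> n; rewrite /exp_coeff /= expr1n ler_wpM2r// lern1 leq_b1.
- exact: is_cvg_series_exp_coeff.
Qed.

(** Far enough along the prefixes of [s i], only [s i] contributes to the
    digits, which then are equal to [d i]; but they vanish from some place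
    on. *)
Lemma exponent_free k (s : 'I_k -> nat -> bool) (d : 'I_k -> int) :
  injective s -> \sum_i (d i)%:~R * exponent (s i) = 0 -> forall i, d i = 0.
Proof.
move=> injs sum0 i.
pose D m : int := \sum_j d j * (codes_prefix (s j) m)%:Z.
pose M := (\sum_j `|d j|)%N.
have DM m : `|(D m)%:~R| <= M%:R :> R.
  rewrite -intr_norm -[M%:R]/((M%:Z)%:~R) ler_int /D.
  apply: le_trans (ler_norm_sum _ _ _) _.
  rewrite /M -natz natr_sum; apply: ler_sum => j _.
  by rewrite normrM natz; case: codes_prefix; rewrite ?mulr1 ?normr0 ?mulr0.
have D0 : \sum_(0 <= m < n) (D m)%:~R / m`!%:R @[n --> \oo] --> (0 : R).
  have E : (fun n => \sum_(0 <= m < n) (D m)%:~R / m`!%:R : R) =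
      (fun n => \sum_j (d j)%:~R * series (term (s j)) n).
    apply/funext => n; under [RHS]eq_bigr do rewrite /series /= mulr_sumr.
    rewrite exchange_big /=; apply: eq_bigr => m _.
    rewrite /D rmorph_sum mulr_suml /=; apply: eq_bigr => j _.
    by rewrite rmorphM /term mulrA.
  rewrite E -[X in _ --> X]sum0.
  apply: cvg_big => [|j _]; first exact: add_continuous.
  by apply: cvgM; [exact: cvg_cst|exact: cvg_exponent].
have D_eq0 := factorial_expansion_eq0 DM D0.
have [N Nneq] : exists N, forall j n, (N <= n)%N -> j != i ->
    codes_prefix (s j) (prefix_code (s i) n) = false.
  have sep j : exists N, forall n, (N <= n)%N -> j != i ->
      codes_prefix (s j) (prefix_code (s i) n) = false.
    have [->|ji] := eqVneq j i; first by exists 0%N.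
    have [|N NE] := @codes_prefix_eventually_neq (s i) (s j).
      by move=> /injs ij; rewrite ij eqxx in ji.
    by exists N => n /NE.
  have [f fE] := choice sep; exists (\max_j f j) => j n Nn.
  by apply: fE; apply: leq_trans Nn; exact: leq_bigmax.
have [n Nn Bn] := prefix_code_unbounded (s i) N (2 * M).
have := D_eq0 _ Bn; rewrite /D (bigD1 i)//= codes_prefixE mulr1 big1 ?addr0//.
by move=> j ji; rewrite Nneq// mulr0.
Qed.

Lemma exponent_inj : injective exponent.
Proof.
move=> s s' ss'; apply: contrapT => neq.
pose p (i : 'I_2) := if val i is 0%N then s else s'.
pose d (i : 'I_2) : int := if val i is 0%N then 1 else -1.
have p_inj : injective p.
  by move=> [[|[|i]] hi] [[|[|j]] hj] //= E;
    [exact: val_inj|case: neq|exact: val_inj].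
have := exponent_free (d := d) p_inj.
rewrite !big_ord_recl big_ord0 ss' addr0 mulN1r mul1r subrr.
by move=> /(_ erefl ord0).
Qed.

End exponents.

(** * Composition with the Gillis function *)

Lemma compact_unit_interval (R : realType) : compact [set: unit_interval R].
Proof. exact/compact_set_type/segment_compact. Qed.

Lemma unit_intervalP (R : realType) (x : unit_interval R) : 0 <= set_val x <= 1.
Proof. by have := set_valP x; rewrite /unit_interval /= in_itv. Qed.

Lemma unit_interval_lift (R : realType) (r : R) : 0 <= r <= 1 ->
  exists x : unit_interval R, set_val x = r.
Proof.
move=> r01; have ur : unit_interval R r by rewrite /unit_interval /= in_itv.
by exists (exist _ r (mem_set ur)).
Qed.

Lemma continuous_ivt (R : realType) (f : R -> R) (u v w : R) :
  continuous f -> f u < w < f v ->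
  exists t, Num.min u v <= t <= Num.max u v /\ f t = w.
Proof.
move=> cf /andP[uw wv].
have wuv : w \in `[f u, f v] by rewrite in_itv /= !ltW.
have [uv|vu] := leP u v.
  have [|||t + <-] := @IVT R f u v w => //; first exact: continuous_subspaceT.
    by rewrite min_l ?max_r ?ltW//; exact: lt_trans wv.
  by rewrite in_itv /=; exists t.
have [|||t + <-] := @IVT R f v u w; [exact: ltW|exact: continuous_subspaceT| |].
  by rewrite min_r ?max_l ?ltW//; exact: lt_trans wv.
by rewrite in_itv /=; exists t.
Qed.

Section composition.
Variables (R : realType) (F h : R -> R).
Hypothesis cF : continuous F.
Hypothesis F_near : forall x e, 0 <= x <= 1 -> 0 < e ->
  exists y, [/\ 0 <= y <= 1, y != x, `|x - y| < e & F y = F x].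
Hypothesis F_osc : forall a b, 0 <= a -> a < b -> b <= 1 ->
  exists u v, [/\ a <= u <= b, a <= v <= b & F u < F v].
Hypothesis ch : continuous h.
Hypothesis h_nonconst : forall a b c, a < b -> exists2 t, a < t < b & h t != c.

Let G (x : unit_interval R) : R := h (F (set_val x)).

Let continuous_hF : continuous (h \o F).
Proof. by move=> x; apply: continuous_comp; [exact: cF|exact: ch]. Qed.

Let continuous_G : continuous G.
Proof.
move=> x; apply: (@continuous_comp _ _ _ set_val (h \o F)).
  exact: initial_continuous.
exact: continuous_hF.
Qed.

(** Gaps: between two points of the level set, [F] sweeps out an interval of
    values, on which [h] is not constantly [y]. *)
Lemma is_cantor_level (y : R) : G @^-1` [set y] !=set0 ->
  is_cantor_set (G @^-1` [set y]).
Proof.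
move=> G0; apply: is_cantor_set_cantor_like => //.
apply: (@cantor_like_subset_line R _ set_val).
- exact: initial_continuous.
- exact: val_inj.
- apply: (subclosed_compact _ (@compact_unit_interval R)) => //.
  by apply: closed_comp => [x _|]; [exact: continuous_G|exact: closed_eq].
- move=> x e /= Gx e0.
  have [r [r01 rx xr Fr]] := F_near (unit_intervalP x) e0.
  have [z zr] := unit_interval_lift r01; exists z; split.
  + by rewrite /G zr Fr.
  + by apply: contra_neq rx => <-.
  + by rewrite -zr in xr.
- move=> a b /= Ga Gb ab.
  have [/andP[a0 _] /andP[_ b1]] := (unit_intervalP a, unit_intervalP b).
  have [u [v [uab vab Fuv]]] := F_osc a0 ab b1.
  have [w uwv hw] := h_nonconst y Fuv.
  have [t [tuv Ft]] := continuous_ivt cF uwv.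
  have tneq : h (F t) != y by rewrite Ft.
  have tab : set_val a <= t <= set_val b.
    move: tuv; rewrite /Num.min /Num.max; case: ifP => _; lra.
  exists t.
    rewrite !lt_neqAle; case/andP: tab => -> ->; rewrite !andbT.
    apply/andP; split; apply: contra_neq tneq.
      by move=> <-.
    by move=> ->.
  by move=> z Gz; apply: contra_neq tneq => <-.
Qed.

Lemma bruckner_garg_rank0_comp : bruckner_garg_rank 0 G.
Proof.
split; first exact: continuous_G.
have chF01 : {within `[0, 1], continuous (h \o F)}.
  exact: continuous_subspaceT.
have [b0 b01 maxb] := EVT_max (ler01 : 0 <= 1 :> R) chF01.
have [a0 a01 mina] := EVT_min (ler01 : 0 <= 1 :> R) chF01.
rewrite !in_itv /= in a01 b01.
have [a aE] := unit_interval_lift a01; have [b bE] := unit_interval_lift b01.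
exists a, b; split.
  move=> x; rewrite /G aE bE; apply/andP; split.
    by apply: mina; rewrite in_itv /= unit_intervalP.
  by apply: maxb; rewrite in_itv /= unit_intervalP.
exists set0; split => //; rewrite setD0 => y; rewrite /= in_itv /= => yab.
apply: is_cantor_level.
have [t [tab hFt]] := @continuous_ivt R (h \o F) (set_val a) (set_val b) y
  continuous_hF yab.
have [|x xt] := @unit_interval_lift R t.
  move: tab (unit_intervalP a) (unit_intervalP b).
  by rewrite /Num.min /Num.max; case: ifP => _; lra.
by exists x; rewrite /= /G xt.
Qed.

End composition.

(** * The free algebra of exponentials *)

Section polynomials.
Variables (R : realType) (k : nat) (P : mpoly.mpoly k R) (beta : 'I_k -> R).

Definition monomial_exponent (m : mpoly.multinom k) : R :=
  \sum_(i < k) beta i *+ mpoly.fun_of_multinom m i.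

Lemma meval_exp (t : R) :
  mpoly.meval (fun i => expR (beta i * t)) P =
  \sum_(m <- mpoly.msupp P) mpoly.mcoeff m P * expR (monomial_exponent m * t).
Proof.
rewrite mpoly.mevalE; apply: eq_bigr => m _; congr (_ * _).
rewrite /monomial_exponent mulr_suml expR_sum; apply: eq_bigr => i _.
by rewrite -expRM_natl mulr_natl mulrnAl.
Qed.

End polynomials.

(* The set of all 0-1 sequences has cardinality 2^omega. *)
Theorem theorem4p13 (R : realType) :
  strongly_algebrable [set: nat -> bool] (@bruckner_garg R).
Proof.
have [F [cF F01 F_near F_osc]] := @gillis_function R.
pose E (s : nat -> bool) (x : unit_interval R) : R :=
  expR (exponent R s * F (set_val x)).
have [u [v [u01 v01 Fuv]]] := F_osc 0 1 (lexx 0) ltr01 (lexx 1).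
(* [F] has a nonzero value, which recovers the exponent. *)
have E_inj : injective E.
  move=> s s' ss'; apply: (@exponent_inj R).
  have [x xv] := unit_interval_lift v01.
  have Fv : F v != 0 by rewrite gt_eqF//; have := F01 u; lra.
  have /expR_inj := congr1 (fun f => f x) ss'; rewrite xv.
  exact: mulIf.
exists (range E); split.
  by apply: inj_card_eq => s s' _ _; exact: E_inj.
move=> k P y k0 P0 Pcst y_inj yE.
have yE' i : exists si, E si = y i by have [si _ siE] := yE i; exists si.
have [s sE] := choice yE'.
have s_inj : injective s.
  by move=> i j sij; apply: y_inj; rewrite -!sE sij.
pose beta i := exponent R (s i).
pose h (t : R) := \sum_(m <- mpoly.msupp P)
  mpoly.mcoeff m P * expR (monomial_exponent beta m * t).
have yh : fun_meval y P = fun x => h (F (set_val x)).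
  apply/funext => x; rewrite /h -meval_exp /fun_meval.
  by apply: mpoly.meval_eq => i; rewrite -sE.
(* Independence is applied to the difference of the two multi-indices. *)
have gam_inj : injective (monomial_exponent beta).
  move=> m1 m2 m12; apply/mpoly.mnmP => i; apply/eqP.
  rewrite -eqz_nat -subr_eq0; apply/eqP.
  apply: (exponent_free (R := R)
    (d := fun i => (mpoly.fun_of_multinom m1 i)%:Z -
                   (mpoly.fun_of_multinom m2 i)%:Z) s_inj).
  under eq_bigr do rewrite rmorphB mulrBl !mulr_natl.
  by rewrite sumrB; apply/eqP; rewrite subr_eq0; apply/eqP.
have gam0 : monomial_exponent beta mpoly.mnm0 = 0.
  by rewrite /monomial_exponent big1// => i _; rewrite mpoly.mnm0E.
have [m mP] : exists m, m \in mpoly.msupp P.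
  case suppP : (mpoly.msupp P) => [|m r]; last by exists m; rewrite mem_head.
  by case: P0; apply/eqP; rewrite -mpoly.msupp_eq0 suppP.
have mcoef : mpoly.mcoeff m P != 0 by rewrite -mpoly.mcoeff_msupp.
have h_nonconst a b c : a < b -> exists2 t, a < t < b & h t != c.
  apply: (expsum_nonconst mP).
  - exact: mcoef.
  - by rewrite map_inj_uniq// mpoly.msupp_uniq.
  - apply: contra_neq mcoef => gm0.
    by rewrite (gam_inj m mpoly.mnm0) ?gam0.
rewrite yh; split; last first.
  exists 0%N; apply: bruckner_garg_rank0_comp => //.
  exact: continuous_expsum.
have [w uwv hw] := h_nonconst _ _ 0 Fuv.
have [t [tuv Ft]] := continuous_ivt cF uwv.
have [|x xt] := @unit_interval_lift R t.
  by move: tuv; rewrite /Num.min /Num.max; case: ifP => _; lra.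
move=> /(congr1 (fun f => f x)) /eqP; rewrite xt Ft.
by apply/negP.
Qed.
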